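(* Let $G\in\mathcal F$. The following conditions are equivalent: (1) $ecvc(G)=cvc(G)$; (2) every vertex of $G$ belongs to some minimum connected vertex cover of $G$; (3) every cycle of $G$ contains at least two vertices whose degree in $G$ is two. Whenever these conditions hold, every minimum connected vertex cover of $G$ is an eternally winning configuration.
   Context: All graphs are finite and simple. A vertex cover of a graph $G$ is a set of vertices meeting every edge; a connected vertex cover is a vertex cover that induces a connected subgraph. $cvc(G)$ is the minimum size of a connected vertex cover of $G$, and a minimum connected vertex cover is one of size $cvc(G)$. $\mathcal F$ is the class of connected graphs $G$ with minimum degree $\delta(G)\ge 2$ such that $cvc(G)=2|V(G)|-|E(G)|-1$. Eternal Connected Vertex Cover game with $k$ guards on a connected graph $G$ with at least one edge: the defender first chooses a set of $k$ vertices and places one guard on each; this set must be a connected vertex cover. In each round the attacker attacks an edge. The defender responds by moving guards simultaneously: each guard stays put or moves to a neighbouring vertex, at least one guard must move across the attacked edge (from one endpoint to the other; guards on both endpoints may exchange positions), and after the movement at most one guard occupies each vertex. The set of occupied vertices must be a connected vertex cover after every response; otherwise (or if no legal response exists) the attacker wins. $ecvc(G)$ is the least $k$ such that the defender with $k$ guards can defend every infinite sequence of attacks. A set $S$ of vertices is an eternally winning configuration if, starting with one guard on each vertex of $S$ (so $|S|$ guards), the defender can defend every infinite sequence of attacks. *)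

(* Defs.v *)
From mathcomp Require Import all_boot all_order all_algebra.
From mathcomp Require Import boolp.

Set Implicit Arguments.
Unset Strict Implicit.
Unset Printing Implicit Defensive.

Record sgraph := SGraph {
  vert :> finType;
  adj : rel vert;
  adj_sym : symmetric adj;
  adj_irrefl : irreflexive adj }.

Section Graph.
Variable G : sgraph.
Implicit Types (S a : {set G}) (v : G).

Definition edges : {set {set G}} :=
  [set a | [exists x, exists y, adj x y && (a == [set x; y])]].

Definition deg v : nat := #|[set w | adj v w]|.

Definition induced S : rel G := [rel x y | [&& x \in S, y \in S & adj x y]].

(* The null graph does not count as connected. *)
Definition connected_set S : bool :=
  (S != set0) && [forall x in S, forall y in S, connect (induced S) x y].

Definition connected_graph : bool := connected_set [set: G].

Definition vertex_cover S : bool := [forall a in edges, S :&: a != set0].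

Definition connected_vertex_cover S : bool :=
  vertex_cover S && connected_set S.

(* In a connected graph [set: G] is a connected vertex cover, so the default
   value of the argmin is irrelevant there. *)
Definition cvc : nat :=
  #|[arg min_(S < [set: G] | connected_vertex_cover S) #|S|]|.

Definition min_connected_vertex_cover S : bool :=
  connected_vertex_cover S && (#|S| == cvc).

(* The guards on S move simultaneously to S' in response to an attack on the
   edge a: the guard on u goes to f u, and a is crossed by the guard on u
   exactly when {u, f u} = a. Guards are indistinguishable and no vertex holds
   two of them, so a configuration is just the set of occupied vertices. *)
Definition legal_response S a S' : bool :=
  [exists f : {ffun G -> G},
    [&& dinjectiveb f (mem S), f @: S == S',
        [forall u in S, (f u == u) || adj u (f u)]
      & [exists u in S, [set u; f u] == a]]].

(* A defence strategy maps the history of attacks, oldest first, to the current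
   configuration; the attacker may thus adapt to the defender's moves, and the
   defender does not know future attacks. *)
Definition winning_strategy (sigma : seq {set G} -> {set G}) : Prop :=
  forall h : seq {set G}, {subset h <= edges} ->
    connected_vertex_cover (sigma h) /\
    forall a, a \in edges -> legal_response (sigma h) a (sigma (rcons h a)).

Definition eternally_winning S : Prop :=
  exists sigma, sigma [::] = S /\ winning_strategy sigma.

(* In a connected graph [set: G] is eternally winning (the guards on the
   attacked edge exchange positions), so the default value of the argmin is
   irrelevant there. *)
Definition ecvc : nat :=
  #|[arg min_(S < [set: G] | `[< eternally_winning S >]) #|S|]|.

Definition is_cycle (c : seq G) : bool :=
  [&& 3 <= size c, cycle (@adj G) c & uniq c].

Definition class_F : Prop :=
  [/\ connected_graph, forall v, 2 <= deg v
    & (cvc%:Z = 2 * #|G|%:Z - #|edges|%:Z - 1)%R].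

End Graph.

(* Main.v *)
Require Import Defs.
From mathcomp Require Import all_boot all_order all_algebra.
From mathcomp Require Import perm boolp zify.

Set Implicit Arguments.
Unset Strict Implicit.
Unset Printing Implicit Defensive.

(** Write n, m for the numbers of vertices and edges. If S is a connected
    vertex cover, its complement is independent, so
      m = e(S) + (sum of deg v over v outside S) >= (|S| - 1) + 2 (n - |S|),
    which is |S| >= 2n - m - 1. Membership in the class says that this bound is
    attained, so a minimum connected vertex cover S induces a tree and every
    vertex outside S has degree exactly two ([min_cover_cycle_free],
    [min_cover_complement_deg]).

    Let (1) be the equality of ecvc and cvc, (2) the covering of every vertex by
    minimum connected vertex covers and (3) the condition on cycles.

    - (1) implies (2): attack an edge at v. If v was not guarded, the guard
      crossing the edge ends up on v ([ecvc_eq_covered]).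
    - (2) implies (3): a cycle C leaves a minimum connected vertex cover at some v,
      of degree two. One containing v is also left by C, at a vertex of degree two
      other than v ([covered_cycle_deg2]).
    - (3) implies that every connected vertex cover S has an answer to every
      attack ([cover_response]), which gives (1) and the last claim. If both
      ends of the attacked edge are in S, the two guards exchange positions.
      Otherwise the edge is xy with x outside S; x has a second neighbour z,
      and x together with a path of S from y to z is a cycle C. By (3), C has a
      vertex w of degree two other than x. The guards on C between w and y each
      take one step towards x, which turns S into S - w + x ([shift_response]).
      Both neighbours of w are on C, hence this set still covers all edges, and
      it is still connected because C - w is a path meeting everything that was
      attached to w ([connected_exchange]). *)

Section Graph.
Variable G : sgraph.
Implicit Types (S T a : {set G}) (u v w x y : G) (c p : seq G).

Lemma edgesP a :
  reflect (exists x y, adj x y /\ a = [set x; y]) (a \in edges G).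
Proof.
rewrite inE; apply: (iffP existsP) => [[x /existsP [y /andP [xy /eqP ->]]]|].
  by exists x, y.
by move=> [x [y [xy ->]]]; exists x; apply/existsP; exists y; rewrite xy eqxx.
Qed.

Lemma adj_edge x y : adj x y -> [set x; y] \in edges G.
Proof. by move=> xy; apply/edgesP; exists x, y. Qed.

Lemma adj_neq x y : adj x y -> x != y.
Proof. by move=> xy; apply: contraTneq xy => ->; rewrite adj_irrefl. Qed.

Lemma vertex_coverP S :
  reflect (forall x y, adj x y -> x \notin S -> y \in S) (vertex_cover S).
Proof.
apply: (iffP forallP) => [cov x y xy xS | cov a].
  have := cov [set x; y]; rewrite adj_edge //= => /set0Pn [z].
  by rewrite !inE => /andP [zS /orP [] /eqP zE]; move: zS; rewrite zE ?(negPf xS).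
apply/implyP => /edgesP [x [y [xy ->]]]; apply/set0Pn.
have [xS | xS] := boolP (x \in S); first by exists x; rewrite !inE xS eqxx.
by exists y; rewrite !inE (cov x y) // eqxx orbT.
Qed.

Lemma connected_setP S :
  reflect (S != set0 /\ {in S &, forall x y, connect (induced S) x y})
          (connected_set S).
Proof.
apply: (iffP andP) => -[S0 H]; split=> //.
  by move=> x y xS yS; have /forall_inP /(_ x xS) /forall_inP /(_ y yS) := H.
by apply/forall_inP => x xS; apply/forall_inP => y yS; apply: H.
Qed.

Lemma induced_sym S : symmetric (induced S).
Proof. by move=> x y; rewrite /induced /= adj_sym andbCA. Qed.

(** * Counting edges *)

Definition edges_within T := [set a in edges G | a \subset T].

Lemma pair_inj v : injective (fun w => [set v; w]).
Proof.
move=> w1 w2 /setP E; have := E w1; rewrite !inE eqxx orbT.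
move/esym/orP=> [] /eqP // w1v; have := E w2; rewrite !inE eqxx orbT.
by move=> /orP [] /eqP ->.
Qed.

(** The counting arguments below all build up a set one vertex at a time with
    this step. *)
Lemma edges_within_add v T : v \notin T ->
  #|edges_within T| + #|[set w in T | adj v w]| <= #|edges_within (v |: T)|.
Proof.
move=> vT; rewrite -(card_imset _ (@pair_inj v)) -cardsUI.
rewrite [_ :&: _](_ : _ = set0) ?cards0 ?addn0; last first.
  apply/setP => a; rewrite !inE; apply: contraNF vT => /andP [/andP [_ aT]].
  by move=> /imsetP [w _ aE]; apply: (subsetP aT); rewrite aE set21.
apply/subset_leq_card/subsetP => a; rewrite in_setU.
case/orP => [|/imsetP [w]]; rewrite !in_set.
  by case/andP => -> aT; rewrite (subset_trans aT) ?subsetUr.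
case/andP => wT vw ->; have := adj_edge vw; rewrite inE => -> /=.
by apply/subsetP => z; rewrite !inE => /orP [] /eqP ->; rewrite ?eqxx ?wT ?orbT.
Qed.

Lemma connected_boundary S T : connected_set S -> T != set0 -> T \proper S ->
  exists2 v, v \in S :\: T & exists2 w, w \in T & adj v w.
Proof.
case/connected_setP=> _ Sc /set0Pn [t tT] /properP [TS [s sS sT]].
have /connectP [p] := Sc t s (subsetP TS _ tT) sS.
elim: p t tT => [|u p IH] t tT /=; first by move=> _ E; rewrite E tT in sT.
case/andP=> /and3P [_ uS tu] pp lp.
have [uT|uT] := boolP (u \in T); first exact: IH uT pp lp.
by exists u; [rewrite inE uT | exists t => //; rewrite adj_sym].
Qed.

(** Growing T to S inside the connected set S costs at least one edge per added
    vertex. For T a single vertex this is the bound |S| - 1 on the edges of S;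
    for T a cycle it improves to |S|. *)
Lemma connected_edges_within S T : connected_set S -> T != set0 -> T \subset S ->
  #|edges_within T| + #|S :\: T| <= #|edges_within S|.
Proof.
move=> Sc; move En: #|S :\: T| => n.
elim: n T En => [|n IH] T En T0 TS.
  move/eqP: En; rewrite addn0 cards_eq0 setD_eq0 => ST.
  by have /eqP -> : S == T by rewrite eqEsubset ST TS.
have TpS : T \proper S.
  rewrite properEneq TS andbT; apply: contra_eq_neq En => ->.
  by rewrite setDv cards0.
have [v vST [w wT vw]] := connected_boundary Sc T0 TpS.
have /setDP [vS vT] := vST.
have vTS : v |: T \subset S by rewrite subUset sub1set vS.
have Dn : #|S :\: (v |: T)| = n.
  by apply/eqP; rewrite setUC -setDDl -eqSS -En (cardsD1 v (S :\: T)) vST.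
have vT0 : v |: T != set0 by apply/set0Pn; exists v; rewrite setU11.
have := IH _ Dn vT0 vTS; have := edges_within_add vT.
have : 0 < #|[set u in T | adj v u]|.
  by apply/card_gt0P; exists w; rewrite inE wT.
lia.
Qed.

(** The complement of a vertex cover is independent, so all edges at a vertex
    outside S go to S and none is counted twice. *)
Lemma cover_edges_sum S : vertex_cover S ->
  #|edges_within S| + \sum_(v in ~: S) deg v <= #|edges G|.
Proof.
move/vertex_coverP=> cov.
(* Add the vertices outside S one by one: each sees all its neighbours. *)
have main T : S \subset T ->
  #|edges_within S| + \sum_(v in T :\: S) deg v <= #|edges_within T|.
  move En: #|T :\: S| => n; elim: n T En => [|n IH] T En ST.
    move/eqP: En; rewrite cards_eq0 setD_eq0 => TS.
    have /eqP -> : S == T by rewrite eqEsubset ST.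
    by rewrite setDv big_set0 addn0.
  have /card_gt0P [v vTS] : 0 < #|T :\: S| by rewrite En.
  have /setDP [vT vS] := vTS.
  have STv : S \subset T :\ v by rewrite subsetD1 ST.
  have ED : (T :\ v) :\: S = (T :\: S) :\ v by rewrite !setDDl setUC.
  have Dn : #|(T :\ v) :\: S| = n.
    by apply/eqP; rewrite ED -eqSS -En [X in _ == X](cardsD1 v) vTS.
  have := @edges_within_add v (T :\ v); rewrite setD11 setD1K // => /(_ isT).
  have := IH _ Dn STv; rewrite (big_setD1 v vTS) /= ED.
  have -> : [set w in T :\ v | adj v w] = [set w | adj v w].
    apply/setP => w; rewrite !inE; case vw: (adj v w); rewrite ?andbF // andbT.
    by rewrite eq_sym (adj_neq vw) (subsetP ST) // (cov v).
  rewrite -/(deg v); lia.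
have := main setT (subsetT _); rewrite setTD => /leq_trans; apply.
by apply/subset_leq_card/subsetP => a; rewrite !in_set => /andP [].
Qed.

(** Where the length at least three of a cycle enters: the two neighbours of v
    on the cycle are distinct. *)
Lemma next_next_neq c v : is_cycle c -> v \in c -> next c (next c v) != v.
Proof.
case/and3P=> sc _ uc vc; case/rot_to: (vc) => i c' E.
have : uniq (v :: c') by rewrite -E rot_uniq.
have : 3 <= size (v :: c') by rewrite -E size_rot.
rewrite -!(next_rot i uc) E; case: c' {E} => [|y [|z c']] //= _.
rewrite !inE !negb_or => /andP [/and3P [vy vz _] _].
by rewrite eqxx /= (eq_sym y v) (negPf vy) eqxx /= eq_sym.
Qed.

Lemma is_cycle_edges c :
  is_cycle c -> #|[set v in c]| <= #|edges_within [set v in c]|.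
Proof.
move=> /[dup] cyc /and3P [sc cc uc].
have inj : {in [set v in c] &, injective (fun v => [set v; next c v])}.
  move=> u v; rewrite !inE => ucc vc E.
  have : u \in [set v; next c v] by rewrite -E set21.
  have : next c u \in [set v; next c v] by rewrite -E set22.
  rewrite !inE => H1 /orP [/eqP // | /eqP uE].
  case/orP: H1 => /eqP H1.
    by have := next_next_neq cyc vc; rewrite -uE H1 eqxx.
  exact: (can_inj (prev_next uc)) H1.
rewrite -(card_in_imset inj); apply/subset_leq_card/subsetP => a.
case/imsetP=> v; rewrite inE => vc ->; rewrite in_set adj_edge ?(next_cycle cc) //=.
by apply/subsetP => z; rewrite !inE => /orP [] /eqP ->; rewrite ?mem_next.
Qed.

(** * Minimum connected vertex covers in the class F *)

Lemma setT_connected_vertex_cover :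
  connected_graph G -> connected_vertex_cover [set: G].
Proof. by move=> Gc; apply/andP; split=> //; apply/vertex_coverP. Qed.

Lemma exists_min_connected_vertex_cover :
  connected_graph G -> exists S, min_connected_vertex_cover S.
Proof.
move=> /setT_connected_vertex_cover covT.
rewrite /min_connected_vertex_cover /cvc; case: arg_minnP => // S covS _.
by exists S; rewrite covS eqxx.
Qed.

Lemma cvc_le S : connected_graph G -> connected_vertex_cover S -> cvc G <= #|S|.
Proof.
move=> /setT_connected_vertex_cover covT covS.
by rewrite /cvc; case: arg_minnP => // T _ ->.
Qed.

Lemma sum_deg_ge T :
  (forall v, 2 <= deg v) -> 2 * #|T| <= \sum_(v in T) deg v.
Proof.
by move=> deg2; rewrite mulnC -sum_nat_const; apply: leq_sum => v _.
Qed.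

(** The defining equation of the class says that the two lower bounds, |S| - 1
    for the edges inside S and 2 for each degree outside S, leave no slack. *)
Lemma class_F_edges S : class_F G -> min_connected_vertex_cover S ->
  (#|edges G| + #|S|).+1 = 2 * #|S| + 2 * #|~: S|.
Proof.
case=> _ _ E /andP [_ /eqP cS]; rewrite -{1}cS in E.
by have := cardsC S; lia.
Qed.

(** A degree above two outside S would push the number of edges over its value
    in the class. *)
Lemma min_cover_complement_deg S v : class_F G ->
  min_connected_vertex_cover S -> v \notin S -> deg v = 2.
Proof.
move=> GF minS vS; have := class_F_edges GF minS.
case: GF => Gc deg2 _; have /andP [/andP [cov Sc] _] := minS.
have := cover_edges_sum cov; rewrite (big_setD1 v) ?inE //=.
have := sum_deg_ge (~: S :\ v) deg2; have := cardsD1 v (~: S); rewrite inE vS add1n.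
have /connected_setP [/set0Pn [r rS] _] := Sc.
have r0 : [set r] != set0 by apply/set0Pn; exists r; rewrite set11.
have := connected_edges_within Sc r0; rewrite sub1set => /(_ rS).
have := cardsD1 r S; rewrite rS add1n; have := deg2 v.
set s := \sum_(_ in _) _; set e := #|edges_within S|; lia.
Qed.

(** A cycle inside S would provide one edge beyond the |S| - 1 that
    connectedness already forces. *)
Lemma min_cover_cycle_free S c : class_F G ->
  min_connected_vertex_cover S -> is_cycle c -> exists2 v, v \in c & v \notin S.
Proof.
move=> GF minS cyc; apply/exists_inP; rewrite -[X in is_true X]negbK.
rewrite negb_exists_in; apply/negP => /forall_inP cS.
have := class_F_edges GF minS.
case: GF => Gc deg2 _; have /andP [/andP [cov Sc] _] := minS.
have := cover_edges_sum cov; have := sum_deg_ge (~: S) deg2.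
have sub : [set v in c] \subset S.
  by apply/subsetP => v; rewrite inE => /cS; rewrite negbK.
have c0 : [set v in c] != set0.
  case: c cyc {cS sub} => // v c _.
  by apply/set0Pn; exists v; rewrite !inE eqxx.
have := connected_edges_within Sc c0 sub; have := is_cycle_edges cyc.
rewrite cardsD (setIidPr sub); have := subset_leq_card sub; lia.
Qed.

(** * Legal responses *)

Lemma exchange_response S x y :
  adj x y -> x \in S -> y \in S -> legal_response S [set x; y] S.
Proof.
move=> xy xS yS; pose f := [ffun u => tperm x y u].
have fE : f =1 tperm x y by move=> u; rewrite ffunE.
have finj : injective f by move=> u v; rewrite !fE; apply: perm_inj.
apply/existsP; exists f; apply/and4P; split.
- by apply/dinjectiveP => u v _ _; apply: finj.
- rewrite eqEcard card_imset // leqnn andbT; apply/subsetP => _ /imsetP [u uS ->].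
  by rewrite fE; case: tpermP => // ->.
- apply/forall_inP => u _; rewrite fE; case: tpermP => [->|->|]; last by rewrite eqxx.
    by rewrite xy orbT.
  by rewrite adj_sym xy orbT.
- by apply/exists_inP; exists x => //; rewrite fE tpermL.
Qed.

(** The guards on the initial segment of y :: p up to w move one step back
    along the path x :: y :: p; all others stay. *)
Lemma shift_response S x y p w :
  x \notin S -> path (@adj G) x (y :: p) -> uniq (x :: y :: p) ->
  {subset y :: p <= S} -> w \in y :: p ->
  legal_response S [set x; y] (x |: S :\ w).
Proof.
move=> xS; set q := y :: p => qpath uxq qS wq.
have uq : uniq q by move: uxq; rewrite cons_uniq => /andP [].
have wS := qS w wq.
have yq : y \in q by rewrite mem_head.
have iy : index y q = 0 by rewrite /= eqxx.
clearbody q; pose moves u := (u \in q) && (index u q <= index w q).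
pose f := [ffun u => if moves u then nth x (x :: q) (index u q) else u].
have my : moves y by rewrite /moves yq iy.
(* A moving guard lands on x or on a vertex whose own guard also moves; this is
   why no moving guard collides with one that stays. *)
have back u : moves u -> nth x (x :: q) (index u q) != x ->
    moves (nth x (x :: q) (index u q)).
  case/andP=> uq'; case iu: (index u q) => [|i] /= iw; first by rewrite eqxx.
  have iq : i < size q by rewrite -index_mem iu in uq'; exact: ltnW.
  by move=> _; rewrite /moves mem_nth // index_uniq //= ltnW.
have finj : {in S &, injective f}.
  move=> u v uS vS; rewrite !ffunE; case: ifP => mu; case: ifP => mv //.
  - have [/andP [uq' _] /andP [vq _]] := (mu, mv).
    move/eqP; rewrite nth_uniq //= ?ltnS ?index_size // => /eqP E.
    by rewrite -(nth_index x uq') E nth_index.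
  - move=> E; have := back u mu; rewrite E mv => /(_ _) H.
    by have /H : v != x by apply: contraNneq xS => <-.
  - move=> E; have := back v mv; rewrite -E mu => /(_ _) H.
    by have /H : u != x by apply: contraNneq xS => <-.
apply/existsP; exists f; apply/and4P; split.
- exact/dinjectiveP.
- rewrite eqEcard card_in_imset // cardsU1 !inE (negPf xS) andbF /=.
  rewrite [X in _ <= X](cardsD1 w) wS leqnn andbT.
  apply/subsetP => _ /imsetP [u uS ->]; rewrite ffunE !inE.
  case: ifP => mu.
    have [-> //|nx] := eqVneq (nth x (x :: q) (index u q)) x; have /andP [vq _] := back u mu nx.
    rewrite qS // andbT /=; apply: contraFneq (ltnn (index w q)) => E.
    have /andP [uq' iw] := mu; apply: leq_trans iw.
    case iu: (index u q) (E) nx => [|i] /=; first by move=> <-; rewrite eqxx.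
    move=> <- _; rewrite index_uniq //.
    by rewrite -index_mem iu in uq'; exact: ltnW.
  rewrite uS andbT; apply/orP; right; apply: contraFneq mu => ->.
  by rewrite /moves wq leqnn.
- apply/forall_inP => u uS; rewrite ffunE; case: ifP => [/andP [uq' _]|]; last by rewrite eqxx.
  have /(pathP x) /(_ (index u q)) := qpath; rewrite index_mem nth_index // => /(_ uq').
  by rewrite adj_sym => ->; rewrite orbT.
- by apply/exists_inP; exists y; rewrite ?qS // ffunE my iy /= setUC.
Qed.

Lemma exists_path_in S y z : connect (induced S) y z -> y != z -> y \in S ->
  exists p, [/\ path (@adj G) y p, last y p = z, uniq (y :: p),
     {subset y :: p <= S} & 0 < size p].
Proof.
move=> /connectP [p0 pp0 ->] {z}; case/shortenP: pp0 => p pp up _ yz yS.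
exists p; split=> //.
- by apply: sub_path pp => u v /and3P [].
- move=> u; rewrite inE => /orP [/eqP -> // |].
  elim: p y pp {up yz yS} => //= v p IH y /andP [/and3P [_ vS _] pp].
  by rewrite inE => /orP [/eqP -> // |]; apply: IH pp.
- by case: p yz {pp up} => //=; rewrite eqxx.
Qed.

(** A walk in S either avoids w or enters w from a neighbour of w, which lies on
    the cycle c. So from every vertex c minus w is reachable without passing
    through w, and c minus w is a path. *)
Lemma connected_exchange S x c w : connected_set S -> is_cycle c ->
  {subset c <= x |: S} -> x \in c -> w \in c -> w != x ->
  (forall u, adj w u -> u \in c) -> connected_set (x |: S :\ w).
Proof.
move=> Sc /and3P [sc cc uc] cS xc wc wx wN; set S' := _ :|: _.
have cS' u : u \in c -> u != w -> u \in S'.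
  by move=> /cS; rewrite !inE => /orP [-> //|->] ->; rewrite orbT.
have csym := sym_connect_sym (@induced_sym S').
(* Rotate c to start at w; the remaining vertices form a path from h. *)
have ccon u v : u \in c -> u != w -> v \in c -> v != w -> connect (induced S') u v.
  case/rot_to: (wc) => i p E.
  have cp : cycle (@adj G) (w :: p) by rewrite -E rot_cycle.
  have up : uniq (w :: p) by rewrite -E rot_uniq.
  have mem_p t : t \in c -> t != w -> t \in p.
    by rewrite -(mem_rot i) E inE => /orP [->|].
  have pS' t : t \in p -> t \in S'.
    move=> tp; apply: cS'; first by rewrite -(mem_rot i) E inE tp orbT.
    by apply: contraTneq tp => ->; have /andP [] := up.
  case: p {E up} cp mem_p pS' => [|h p] cp mem_p pS'; first by move=> /mem_p H /H.
  have hcon t : t \in h :: p -> connect (induced S') h t.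
    move: cp; rewrite /= rcons_path => /and3P [_ pp _] tp.
    have sub s : s \in h :: p -> s \in S' by apply: pS'.
    elim: p h pp tp sub {mem_p pS'} => [|k p IH] h /=.
      by move=> _; rewrite inE => /eqP -> _; apply: connect0.
    case/andP=> hk pp; rewrite inE => /orP [/eqP -> _|tp sub]; first exact: connect0.
    apply: (@connect_trans _ _ k); last first.
      by apply: IH => // s sp; apply: sub; rewrite inE sp orbT.
    by apply/connect1/and3P; split=> //; apply: sub; rewrite !inE eqxx ?orbT.
  move=> uc' uw vc vw; apply: (@connect_trans _ _ h); last exact/hcon/mem_p.
  by rewrite csym; apply/hcon/mem_p.
(* Follow a walk in S towards a vertex of c in S, stopping if the
   next step would enter w. *)
have tocyc u : u \in S' -> connect (induced S') u x.
  have xw : x != w by rewrite eq_sym.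
  rewrite 2!inE => /orP [/eqP ->|]; first exact: connect0.
  case/setD1P=> uw uS; have [v vc vS] : exists2 v, v \in c & v \in S.
    by exists w => //; have := cS w wc; rewrite !inE (negPf wx).
  have /connected_setP [_ Sc'] := Sc; have /connectP [p pp lp] := Sc' u v uS vS.
  elim: p u uw uS pp lp => [|t p IH] u uw uS /=.
    by move=> _ vE; apply: ccon; rewrite -?vE // vE.
  case/andP=> /and3P [_ tS ut] pp lp.
  have [tw|tw] := eqVneq t w.
    by apply: ccon => //; apply: wN; rewrite -tw adj_sym.
  apply: (@connect_trans _ _ t); last exact: IH.
  by apply/connect1/and3P; rewrite !inE uw uS tw tS !orbT.
apply/connected_setP; split; first by apply/set0Pn; exists x; rewrite !inE eqxx.
move=> u v uS' vS'; apply: (@connect_trans _ _ x); first exact: tocyc.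
by rewrite csym; apply: tocyc.
Qed.

Lemma deg2_neighbours c w : is_cycle c -> w \in c -> deg w = 2 ->
  forall u, adj w u -> u \in c.
Proof.
move=> /[dup] cyc /and3P [sc cc uc] wc dw u wu.
have nw : adj w (next c w) by apply: next_cycle.
have pw : adj w (prev c w) by rewrite adj_sym; apply: prev_cycle.
(* These are two distinct neighbours, hence all of them. *)
have np : next c w != prev c w.
  by apply: contra_neq (next_next_neq cyc wc) => ->; rewrite next_prev.
have NE : [set next c w; prev c w] = [set v | adj w v].
  apply/eqP; rewrite eqEcard cards2 np -/(deg w) dw andbT.
  by apply/subsetP => v; rewrite !inE => /orP [] /eqP ->.
have : u \in [set next c w; prev c w] by rewrite NE inE.
by rewrite !inE => /orP [] /eqP ->; rewrite ?mem_next ?mem_prev.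
Qed.

Lemma legal_response_card S a S' : legal_response S a S' -> #|S'| = #|S|.
Proof.
case/existsP=> f /and4P [/dinjectiveP fi /eqP <- _ _].
by rewrite card_in_imset.
Qed.

Lemma legal_response_attacked S v w S' :
  v \notin S -> legal_response S [set v; w] S' -> v \in S'.
Proof.
move=> vS /existsP [f /and4P [_ /eqP <- _ /exists_inP [u uS /eqP E]]].
have := set21 v w; rewrite -E !inE => /orP [/eqP vu|/eqP ->].
  by rewrite vu uS in vS.
exact: imset_f.
Qed.

Lemma cover_response S a : (forall v, 2 <= deg v) ->
  (forall c, is_cycle c -> 2 <= #|[set v in c | deg v == 2]|) ->
  connected_vertex_cover S -> a \in edges G ->
  exists S', connected_vertex_cover S' /\ legal_response S a S'.
Proof.
move=> deg2 cyc2 /[dup] covS /andP [/vertex_coverP cov Sc] /edgesP [x0 [y0 [xy0 aE]]].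
have [/andP [xS yS]|] := boolP ((x0 \in S) && (y0 \in S)).
  by exists S; rewrite aE; split; last exact: exchange_response.
rewrite negb_and => nS.
have {nS x0 y0 xy0 aE} [x [y [xy -> xS]]] :
    exists x y, [/\ adj x y, a = [set x; y] & x \notin S].
  case/orP: nS => ?; first by exists x0, y0.
  by exists y0, x0; rewrite adj_sym setUC.
have yS := cov x y xy xS.
have [z xz yz] : exists2 z, adj x z & y != z.
  have /card_gt1P [z1 [z2 []]] := deg2 x; rewrite !inE => xz1 xz2 z12.
  have [yz1|yz1] := eqVneq y z1; last by exists z1.
  by exists z2 => //; rewrite yz1.
have zS := cov x z xz xS.
have /connected_setP [_ /(_ y z yS zS) yzc] := Sc.
have [p [pp lp up pS p0]] := exists_path_in yzc yz yS.
have ux : uniq (x :: y :: p) by rewrite cons_uniq up andbT; apply: contra xS => /pS.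
pose c := x :: y :: p.
have cyc : is_cycle c.
  by apply/and3P; split=> //; rewrite /= xy rcons_path pp lp adj_sym xz.
have [w [wc /eqP dw wx]] : exists w, [/\ w \in c, deg w == 2 & w != x].
  have /card_gt1P [w1 [w2 []]] := cyc2 c cyc; rewrite !inE -!in_cons.
  case/andP=> w1c d1 /andP [w2c d2] w12.
  have [w1x|w1x] := eqVneq w1 x; last by exists w1.
  by exists w2; split=> //; rewrite -w1x eq_sym.
have wN := deg2_neighbours cyc wc dw.
have wp : w \in y :: p by move: wc; rewrite inE (negPf wx).
exists (x |: S :\ w); split; last by apply: (@shift_response S x y p) => //; rewrite /= xy.
have cS : {subset c <= x |: S}.
  by move=> u; rewrite !inE => /orP [-> //|up']; rewrite (pS u) ?orbT // inE.
apply/andP; split; last by apply: (connected_exchange Sc cyc) => //; rewrite mem_head.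
(* The vertices outside S - w + x are w, whose neighbours lie on c, and the
   vertices other than x outside S, which are not on c and so not adjacent
   to w. *)
apply/vertex_coverP => u v uv; rewrite !inE !negb_or => /andP [ux' uS].
have [uw|uw] := eqVneq u w.
  rewrite uw in uv; have := cS v (wN v uv); rewrite !inE => /orP [-> //|->].
  by rewrite (eq_sym v w) (adj_neq uv) orbT.
rewrite uw /= in uS; rewrite (cov u v) // andbT.
have [vw|_] := eqVneq v w; last by rewrite orbT.
have := cS u; rewrite wN -?vw 1?adj_sym // !inE (negPf ux') (negPf uS).
by move/(_ isT).
Qed.

(** * Strategies and the three conditions *)

(** An invariant that can be restored after every single attack yields a
    strategy: it needs only the current configuration, so it is a fold of the
    one-step response over the history. *)
Lemma winning_of_invariant (P : pred {set G}) S : P S ->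
  (forall T, P T -> connected_vertex_cover T) ->
  (forall T a, P T -> a \in edges G -> exists T', P T' /\ legal_response T a T') ->
  eternally_winning S.
Proof.
move=> PS Pcov step.
pose next_conf T a := odflt T [pick T' | P T' && legal_response T a T'].
have nextP T a : P T -> a \in edges G ->
    P (next_conf T a) /\ legal_response T a (next_conf T a).
  move=> PT /(step T a PT) [T' [PT' leg]]; rewrite /next_conf.
  by case: pickP => [T'' /andP [] //|/(_ T')]; rewrite PT' leg.
exists (foldl next_conf S); split=> // h hE.
have Ph : P (foldl next_conf S h).
  elim/last_ind: h hE => //= h a IH hE; rewrite foldl_rcons.
  have sub : {subset h <= edges G}.
    by move=> b bh; apply: hE; rewrite mem_rcons inE bh orbT.
  by have [] := nextP _ a (IH sub) (hE a _); rewrite // mem_rcons mem_head.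
by split=> [|a aE]; [exact: Pcov | rewrite foldl_rcons; have [] := nextP _ a Ph aE].
Qed.

Lemma setT_eternally_winning : connected_graph G -> eternally_winning [set: G].
Proof.
move=> Gc; apply: (@winning_of_invariant (pred1 [set: G])) => //=.
  by move=> T /eqP ->; apply: setT_connected_vertex_cover.
move=> T a /eqP -> /edgesP [x [y [xy ->]]]; exists setT.
by split=> //; apply: exchange_response; rewrite ?inE.
Qed.

Lemma eternally_winning_cover S : eternally_winning S -> connected_vertex_cover S.
Proof. by case=> sigma [<- /(_ [::])] []. Qed.

Lemma exists_optimal_eternally_winning : connected_graph G ->
  exists2 S : {set G}, eternally_winning S & #|S| = ecvc G.
Proof.
move/setT_eternally_winning=> winT; rewrite /ecvc.
case: arg_minnP => [|S /asboolP winS _]; first exact/asboolP.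
by exists S.
Qed.

Lemma ecvc_le S : connected_graph G -> eternally_winning S -> ecvc G <= #|S|.
Proof.
move=> /setT_eternally_winning winT winS; rewrite /ecvc.
case: arg_minnP => [|T _]; first exact/asboolP.
by apply; apply/asboolP.
Qed.

(** If v is not guarded, an attack on an edge at v forces a guard onto v. *)
Lemma ecvc_eq_covered v : connected_graph G -> 0 < deg v -> ecvc G = cvc G ->
  exists S, min_connected_vertex_cover S /\ v \in S.
Proof.
move=> Gc /card_gt0P [w]; rewrite inE => vw E.
have [S [sigma [S0 win]] cS] := exists_optimal_eternally_winning Gc.
have sub1 : {subset [:: [set v; w]] <= edges G}.
  by move=> a; rewrite inE => /eqP ->; apply: adj_edge.
have sub0 : {subset [::] <= edges G} by [].
have [cov /(_ _ (adj_edge vw)) /= leg] := win _ sub0.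
have [cov' _] := win _ sub1.
rewrite S0 in cov leg.
have [vS|vS] := boolP (v \in S).
  by exists S; rewrite /min_connected_vertex_cover cov cS E eqxx.
exists (sigma [:: [set v; w]]); split; last exact: legal_response_attacked leg.
by rewrite /min_connected_vertex_cover cov' (legal_response_card leg) cS E eqxx.
Qed.

(** Two minimum covers, one containing the vertex that the cycle misses in the
    other, give two distinct missed vertices. *)
Lemma covered_cycle_deg2 : class_F G ->
  (forall v, exists S, min_connected_vertex_cover S /\ v \in S) ->
  forall c, is_cycle c -> 2 <= #|[set v in c | deg v == 2]|.
Proof.
move=> GF covered c cyc.
have [S0 minS0] : exists S, min_connected_vertex_cover S.
  by apply: exists_min_connected_vertex_cover; case: GF.
have [v vc vS0] := min_cover_cycle_free GF minS0 cyc.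
have [S [minS vS]] := covered v.
have [w wc wS] := min_cover_cycle_free GF minS cyc.
apply/card_gt1P; exists v, w; rewrite !inE vc wc.
rewrite (min_cover_complement_deg GF minS0 vS0).
rewrite (min_cover_complement_deg GF minS wS).
by split=> //; apply: contraNneq wS => <-.
Qed.

Lemma cycle_deg2_eternally_winning S :
  (forall v, 2 <= deg v) ->
  (forall c, is_cycle c -> 2 <= #|[set v in c | deg v == 2]|) ->
  min_connected_vertex_cover S -> eternally_winning S.
Proof.
move=> deg2 cyc2 minS; apply: winning_of_invariant minS _ _ => [T /andP [] //|].
move=> T a /andP [covT /eqP cT] aE.
have [T' [covT' leg]] := cover_response deg2 cyc2 covT aE.
exists T'; split=> //.
by rewrite /min_connected_vertex_cover covT' (legal_response_card leg) cT eqxx.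
Qed.

Lemma ecvc_eq_cvc S : connected_graph G ->
  min_connected_vertex_cover S -> eternally_winning S -> ecvc G = cvc G.
Proof.
move=> Gc /andP [_ /eqP cS] winS; apply/eqP; rewrite eqn_leq -{1}cS ecvc_le //.
have [T /eternally_winning_cover covT <-] := exists_optimal_eternally_winning Gc.
exact: cvc_le.
Qed.

End Graph.

Theorem theorem2 (G : sgraph) (hG : class_F G) :
  [/\ ecvc G = cvc G <->
        (forall v : G, exists S : {set G},
           min_connected_vertex_cover S /\ v \in S),
      (forall v : G, exists S : {set G},
         min_connected_vertex_cover S /\ v \in S) <->
        (forall c : seq G, is_cycle c ->
           2 <= #|[set v in c | deg v == 2]|)
    & ecvc G = cvc G ->
        forall S : {set G}, min_connected_vertex_cover S ->
          eternally_winning S].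
Proof.
have [Gc deg2 _] := hG.
have one_two (E : ecvc G = cvc G) v := ecvc_eq_covered Gc (ltnW (deg2 v)) E.
have two_three := covered_cycle_deg2 hG.
have three_win cyc2 S := @cycle_deg2_eternally_winning G S deg2 cyc2.
have three_one : (forall c : seq G, is_cycle c ->
    2 <= #|[set v in c | deg v == 2]|) -> ecvc G = cvc G.
  have [S minS] := exists_min_connected_vertex_cover Gc.
  by move=> cyc2; apply: (ecvc_eq_cvc Gc minS); apply: three_win.
split; first by split=> [/one_two //|/two_three /three_one].
- by split=> [/two_three //|/three_one /one_two].
- by move=> /one_two /two_three /three_win.
Qed.
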